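(* Let $n\ge 2$ and let $\lambda\in\mathbb{R}^n$ satisfy $\lambda_1\ge\lambda_2\ge\dots\ge\lambda_n$ and $\lambda_i-\lambda_j\in\mathbb{Z}$ for all $i,j$. Suppose $\lambda_1>\lambda_2$, and let $q\in[2,n]$ be the integer such that $\lambda_2=\dots=\lambda_q$ and, in case $q<n$, $\lambda_q>\lambda_{q+1}$. Suppose that $$\lambda_1+\lambda_2<-2n+q+2 .$$ Let $s\ne 0$ be of the form $s=(b_1,b_1,b_2,b_2,\dots,b_j,b_j,0,\dots,0)\in\mathbb{Z}^n$ for some $j$ with $1\le j\le[n/2]$ and some positive integers $b_1\ge b_2\ge\dots\ge b_j$. Then $$\|(\lambda-s)^++\rho\|^2>\|\lambda+\rho\|^2 .$$
   Context: This is the case $\mathfrak{g}_0=\mathfrak{so}^*(2n)$. Here $\rho=(n-1,n-2,\dots,1,0)$ and $\|\cdot\|$ is the standard Euclidean norm on $\mathbb{R}^n$. The Weyl group $W_{\mathfrak{k}}$ acts on $\mathbb{R}^n$ by all permutations of the coordinates, and for $\mu\in\mathbb{R}^n$, $\mu^+$ denotes the unique $W_{\mathfrak{k}}$-conjugate of $\mu$ with coordinates in weakly decreasing order. $[x]$ denotes the integer part of $x$. *)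

(* Defs.v *)
From mathcomp Require Import all_boot all_order all_algebra all_fingroup.
From mathcomp Require Import reals.

Set Implicit Arguments.
Unset Strict Implicit.
Unset Printing Implicit Defensive.

Import Order.TTheory GRing.Theory Num.Theory.

Local Open Scope ring_scope.

(* Elements of R^n are row vectors with coordinates indexed from 0: the
   coordinate written mu_i on paper (1 <= i <= n) is [mu 0 (i - 1)]. *)

Definition enorm (R : realType) (n : nat) (x : 'rV[R]_n) : R :=
  Num.sqrt (\sum_(i < n) x 0 i ^+ 2).

(* (n-1, n-2, ..., 1, 0) *)
Definition rho (R : realType) (n : nat) : 'rV[R]_n :=
  \row_(i < n) (n%:R - i.+1%:R).

(* Conjugation under the Weyl group of k, i.e. 'S_n permuting coordinates. *)
Definition wk_conj (R : realType) (n : nat) (mu nu : 'rV[R]_n) : Prop :=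
  exists w : 'S_n, nu = col_perm w mu.

Definition decreasing (R : realType) (n : nat) (mu : 'rV[R]_n) : bool :=
  [forall i : 'I_n, forall j : 'I_n, (i <= j)%N ==> (mu 0 j <= mu 0 i)].

(* The default branch is never taken: see [domr_conj] and [decreasing_domr]. *)
Definition domr (R : realType) (n : nat) (mu : 'rV[R]_n) : 'rV[R]_n :=
  if [pick w : 'S_n | decreasing (col_perm w mu)] is Some w
  then col_perm w mu else mu.

Lemma decreasingP (R : realType) (n : nat) (mu : 'rV[R]_n) :
  reflect (forall i j : 'I_n, (i <= j)%N -> mu 0 j <= mu 0 i) (decreasing mu).
Proof.
apply: (iffP forallP) => [H i j ij | H i].
  by have /forallP/(_ j)/implyP/(_ ij) := H i.
by apply/forallP => j; apply/implyP; apply: H.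
Qed.

Lemma decreasing_sorted (R : realType) (n : nat) (mu : 'rV[R]_n) :
  decreasing mu = sorted >=%R [tuple mu 0 i | i < n].
Proof.
have ge_trans : transitive (>=%R : rel R) by move=> y x z xy /le_trans; apply.
apply/decreasingP/idP => [H | H i j ij].
  apply/(sortedP (0 : R)) => k; rewrite size_tuple => kn.
  rewrite -(tnth_nth _ _ (Ordinal (ltnW kn))) -(tnth_nth _ _ (Ordinal kn)).
  by rewrite !tnth_mktuple; apply: H => /=.
have := sorted_leq_nth ge_trans (fun x => lexx x) (0 : R) H.
move=> /(_ i j); rewrite !inE size_tuple => /(_ (ltn_ord i) (ltn_ord j) ij).
by rewrite -!tnth_nth !tnth_mktuple.
Qed.

Lemma exists_decreasing (R : realType) (n : nat) (mu : 'rV[R]_n) :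
  exists w : 'S_n, decreasing (col_perm w mu).
Proof.
have /tuple_permP [w Hw] :
  perm_eq (sort_tuple >=%R [tuple mu 0 i | i < n]) [tuple mu 0 i | i < n].
  by rewrite perm_sort.
exists w; rewrite decreasing_sorted.
have -> : [tuple col_perm w mu 0 i | i < n] =
          [tuple tnth [tuple mu 0 i | i < n] (w i) | i < n].
  by apply: eq_from_tnth => i; rewrite !tnth_mktuple mxE.
by rewrite -Hw; apply: sort_sorted => x y; rewrite orbC; apply: le_total.
Qed.

Lemma decreasing_domr (R : realType) (n : nat) (mu : 'rV[R]_n) :
  decreasing (domr mu).
Proof.
rewrite /domr; case: pickP => // H.
by have [w] := exists_decreasing mu; rewrite H.
Qed.

Lemma domr_conj (R : realType) (n : nat) (mu : 'rV[R]_n) : wk_conj mu (domr mu).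
Proof.
rewrite /domr; case: pickP => [w _ | _]; first by exists w.
by exists 1%g; rewrite col_perm1.
Qed.

Lemma domr_unique (R : realType) (n : nat) (mu nu : 'rV[R]_n) :
  wk_conj mu nu -> decreasing nu -> nu = domr mu.
Proof.
have conj_perm (x : 'rV[R]_n) : wk_conj mu x ->
    perm_eq [tuple x 0 i | i < n] [tuple mu 0 i | i < n].
  case=> w ->; apply/tuple_permP; exists w; congr (val _).
  by apply: eq_from_tnth => i; rewrite !tnth_mktuple mxE.
move=> /conj_perm pnu; rewrite decreasing_sorted => snu.
have := decreasing_domr mu; rewrite decreasing_sorted => sdom.
have pdom := conj_perm _ (domr_conj mu).
have E : [tuple nu 0 i | i < n] = [tuple domr mu 0 i | i < n] :> seq R.
  apply: (sorted_eq (leT := >=%R)) => //.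
  - by move=> y x z xy /le_trans; apply.
  - by move=> x y; rewrite andbC => /le_anti.
  - by rewrite (perm_trans pnu) // perm_sym.
apply/rowP => i; have /val_inj /(congr1 (fun t => tnth t i)) := E.
by rewrite !tnth_mktuple.
Qed.

(* (b_0, b_0, b_1, b_1, ..., b_(j-1), b_(j-1), 0, ..., 0) *)
Definition doubled (n j : nat) (b : nat -> int) : 'rV[int]_n :=
  \row_(i < n) (if (i < 2 * j)%N then b i./2 else 0).

(* Main.v *)
Require Import Defs.
From mathcomp Require Import all_boot all_order all_algebra all_fingroup.
From mathcomp Require Import reals.
From mathcomp Require Import zify lra.

Local Open Scope ring_scope.

Import Order.TTheory GRing.Theory Num.Theory.

(** Since [rho] is decreasing, the decreasing rearrangement maximizes
    [<w mu, rho>] over all permutations [w], so for every [w]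
      [|mu^+ + rho|^2 >= |w mu + rho|^2]        ([enorm_domr_add_rho_ge]).
    It therefore suffices to find one good [w] for [mu = lambda - s].  Take for
    [w] the reversal of the coordinates [2, ..., q], on which [lambda] is
    constant while [- s] increases.  As [w] is an involution fixing [lambda],
      [|w (lambda - s) + rho|^2 - |lambda + rho|^2
         = |s|^2 - 2 <lambda + w rho, s>],
    and grouping equal coordinates of [s] this is [2 sum_k b_k (b_k - c_k)],
    where [c_k] is the sum of the [k]-th pair of consecutive coordinates of
    [lambda + w rho].  As [b_k >= 1], it is at least
    [2 sum_k b_k (1 - c_k)], and because [b] is positive and decreasing,
    Abel summation ([sum_mul_partial_sums_gt0]) leaves only the positivity of
    the partial sums of [1 - c_k] to be shown.

    The first pair gives [c_0 = lambda_1 + lambda_2 + 2n - 1 - q < 1], which is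
    exactly the hypothesis on [lambda_1 + lambda_2].  Integrality gives
    [lambda_1 >= lambda_2 + 1], hence [2 lambda_2 < - 2n + q + 1], which
    bounds the other pairs.  Inside the block the single terms [1 - c_k] may be
    negative, but their lower bounds form a decreasing arithmetic progression
    whose partial sums are nonnegative as long as the pairs stay within the
    block; past the block the terms are positive
    ([pair_defect_partial_sums_gt0]). *)

Lemma enorm_sqr (R : realType) (n : nat) (x : 'rV[R]_n) :
  enorm x ^+ 2 = \sum_(i < n) x 0 i ^+ 2.
Proof. by rewrite sqr_sqrtr // sumr_ge0 // => i _; rewrite sqr_ge0. Qed.

Lemma enorm_add_sqr (R : realType) (n : nat) (x y : 'rV[R]_n) :
  enorm (x + y) ^+ 2 =
  \sum_(i < n) x 0 i ^+ 2 + 2 * (\sum_(i < n) x 0 i * y 0 i)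
  + \sum_(i < n) y 0 i ^+ 2.
Proof.
rewrite enorm_sqr mulr_sumr -!big_split /=; apply: eq_bigr => i _.
by rewrite mxE sqrrD -mulr_natl.
Qed.

(** Writing [rho] as a sum of indicators of initial segments reduces pairings
    with [rho] to sums of initial coordinates. *)
Lemma rho_count (R : realType) (n : nat) (i : 'I_n) :
  rho R n 0 i = \sum_(m < n) (i < m)%N%:R.
Proof.
rewrite mxE -natrB // -natr_sum; congr (_%:R).
rewrite -(big_mkord xpredT (fun m => (i < m)%N : nat)).
rewrite (@big_cat_nat _ _ _ i.+1) //= big_nat big1 ?add0n; last first.
  by move=> m /andP[_ lm]; rewrite ltnNge -ltnS lm.
rewrite big_nat (eq_bigr (fun=> 1%N)) => [|m /andP[-> //]].
by rewrite -big_nat sum_nat_const_nat muln1.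
Qed.

(** The indicator of an initial segment and a permutation of it have the same
    sum, so [nu] may be replaced by [nu - nu_m]; this is nonnegative on the
    segment and nonpositive off it, and the comparison becomes termwise. *)
Lemma partial_sum_perm_le (R : realType) (n : nat) (nu : 'rV[R]_n)
    (w : 'S_n) (m : 'I_n) :
  decreasing nu ->
  \sum_(i < n) nu 0 (w i) * (i < m)%N%:R <= \sum_(i < n) nu 0 i * (i < m)%N%:R.
Proof.
move=> /decreasingP nu_decr.
have balance : \sum_(i < n) nu 0 m * ((w^-1)%g i < m)%N%:R
             = \sum_(i < n) nu 0 m * (i < m)%N%:R.
  rewrite (reindex_inj (@perm_inj _ w)) /=.
  by apply: eq_bigr => i _; rewrite permK.
rewrite (reindex_inj (@perm_inj _ (w^-1)%g)) /=.
under eq_bigr do rewrite permKV.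
rewrite -(lerD2r (- \sum_(i < n) nu 0 m * (i < m)%N%:R)).
rewrite -{1}balance -!sumrB; apply: ler_sum => i _.
rewrite -!mulrBl; case: (ltnP i m) => im.
  by rewrite ler_wpM2l ?subr_ge0 ?nu_decr ?(ltnW im) // ler_nat leq_b1.
by rewrite mulr0 mulr_le0_ge0 // subr_le0 nu_decr.
Qed.

(** The rearrangement inequality for [rho], summed over the layers of
    [rho_count]. *)
Lemma perm_dot_rho_le (R : realType) (n : nat) (nu : 'rV[R]_n) (w : 'S_n) :
  decreasing nu ->
  \sum_(i < n) nu 0 (w i) * rho R n 0 i <= \sum_(i < n) nu 0 i * rho R n 0 i.
Proof.
move=> nu_decr.
have layers (u : 'S_n) : \sum_(i < n) nu 0 (u i) * rho R n 0 i
    = \sum_(m < n) \sum_(i < n) nu 0 (u i) * (i < m)%N%:R.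
  rewrite exchange_big; apply: eq_bigr => i _.
  by rewrite rho_count mulr_sumr.
under [leRHS]eq_bigr do rewrite -[X in nu 0 X]perm1.
rewrite !layers; apply: ler_sum => m _.
under [leRHS]eq_bigr do rewrite perm1.
exact: partial_sum_perm_le.
Qed.

(** Permuting coordinates preserves [|mu|^2], so only the pairing with [rho]
    changes, and the dominant conjugate maximizes it. *)
Lemma enorm_domr_add_rho_ge (R : realType) (n : nat) (mu : 'rV[R]_n)
    (w : 'S_n) :
  enorm (col_perm w mu + rho R n) ^+ 2 <= enorm (domr mu + rho R n) ^+ 2.
Proof.
have [v domrE] := domr_conj mu; have := @decreasing_domr R n mu.
have norm_perm (u : 'S_n) :
    \sum_(i < n) col_perm u mu 0 i ^+ 2 = \sum_(i < n) mu 0 i ^+ 2.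
  rewrite [RHS](reindex_inj (@perm_inj _ u)) /=.
  by apply: eq_bigr => i _; rewrite mxE.
rewrite domrE => nu_decr; rewrite !enorm_add_sqr !norm_perm.
rewrite lerD2r lerD2l ler_wpM2l //.
rewrite (le_trans _ (@perm_dot_rho_le _ _ _ (w * v^-1)%g nu_decr)) //.
by apply: ler_sum => i _; rewrite !mxE permM permKV.
Qed.

Lemma sum_pairs (V : nmodType) (F : nat -> V) (j : nat) :
  \sum_(i < 2 * j) F i = \sum_(k < j) (F (2 * k)%N + F (2 * k).+1).
Proof.
elim: j => [|j IHj]; first by rewrite !big_ord0.
have -> : (2 * j.+1 = (2 * j).+2)%N by lia.
by rewrite !big_ord_recr /= IHj addrA.
Qed.

(** Abel summation: the sum dominates the last weight times the last partial
    sum of [d], since lowering a weight to the next one costs a nonnegative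
    multiple of a positive partial sum. *)
Lemma sum_mul_partial_sums_gt0 (R : realDomainType) (j : nat) (b d : nat -> R) :
  (0 < j)%N ->
  (forall k, (k < j)%N -> 0 < b k) ->
  (forall k, (k.+1 < j)%N -> b k.+1 <= b k) ->
  (forall k, (0 < k <= j)%N -> 0 < \sum_(i < k) d i) ->
  0 < \sum_(k < j) b k * d k.
Proof.
case: j => // j _ b_pos b_decr d_pos.
suff {b_pos} le_sum k : (k <= j)%N ->
    b k * (\sum_(i < k.+1) d i) <= \sum_(i < k.+1) b i * d i.
  by apply: lt_le_trans (le_sum j (leqnn j)); rewrite mulr_gt0 ?b_pos ?d_pos ?leqnn.
elim: k => [_|k IHk kj]; first by rewrite !big_ord_recr !big_ord0 /= !add0r.
rewrite big_ord_recr [leRHS]big_ord_recr /= mulrDr lerD2r.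
apply: le_trans (IHk (ltnW kj)).
by rewrite ler_wpM2r ?b_decr // ltW // d_pos /=; lia.
Qed.

(** The permutation [w], with coordinates indexed from 0: the block
    [2, ..., q] becomes [1 <= k < q]. *)
Definition block_rev (q k : nat) : nat :=
  if (1 <= k < q)%N then (q - k)%N else k.

Lemma block_revK (q k : nat) : block_rev q (block_rev q k) = k.
Proof. by rewrite /block_rev; have [h|h] := boolP (1 <= k < q)%N; case: ifP; lia. Qed.

Lemma ltn_block_rev (n q k : nat) :
  (q <= n)%N -> (k < n)%N -> (block_rev q k < n)%N.
Proof. by rewrite /block_rev; case: ifP; lia. Qed.

(** The coordinates of [lambda + w rho], for [x] the coordinates of [lambda]. *)
Definition shifted (R : realFieldType) (n q : nat) (x : nat -> R) (k : nat) : R :=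
  x k + (n%:R - (block_rev q k).+1%:R).

(** Up to the [K]-th pair inside the block, the bounds [q + 1 - 4k] on the
    terms [1 <= k < K] add up to [(K - 1)(q + 1 - 2K)], which is nonnegative
    when [2K <= q]; afterwards only positive terms are added. *)
Lemma pair_defect_partial_sums_gt0 (R : realFieldType) (n q : nat) (x : nat -> R) :
  (2 <= q <= n)%N ->
  (forall k, (1 <= k < q)%N -> x k = x 1%N) ->
  (forall k, (1 <= k < n)%N -> x k <= x 1%N) ->
  x 1%N + 1 <= x 0%N ->
  x 0%N + x 1%N < - (2 * n%:R) + q%:R + 2 ->
  forall K, (0 < K)%N -> (2 * K <= n)%N ->
  0 < \sum_(k < K)
        (1 - (shifted R n q x (2 * k)%N + shifted R n q x (2 * k).+1)).
Proof.
move=> /andP[q2 qn] x_block x_le x01 x_lt.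
set d := fun k => 1 - (shifted R n q x (2 * k)%N + shifted R n q x (2 * k).+1).
have d0 : 0 < d 0%N.
  rewrite /d /shifted /block_rev /= q2 subn1 prednK ?(ltnW q2) //; lra.
have d_block k : (0 < k)%N -> ((2 * k).+1 < q)%N -> q%:R + 1 - 4 * k%:R < d k.
  move=> k0 kq; rewrite /d /shifted /block_rev.
  have -> : (1 <= 2 * k < q)%N by lia.
  have -> : (1 <= (2 * k).+1 < q)%N by lia.
  rewrite !x_block; [|lia|lia].
  have -> : (q - (2 * k).+1).+1 = (q - 2 * k)%N by lia.
  rewrite -[(q - 2 * k).+1]addn1 natrD natrB ?natrM; [lra|lia].
have d_far k : (0 < k)%N -> (q <= (2 * k).+1 < n)%N -> 0 < d k.
  move=> k0 /andP[qk kn]; rewrite /d /shifted.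
  have x2k : x (2 * k)%N <= x 1%N by apply: x_le; lia.
  have x2k1 : x (2 * k).+1 <= x 1%N by apply: x_le; lia.
  (* The extreme case is the pair straddling the end of the block, where the
     reversal sends position [q - 1] to 1 and fixes position [q]. *)
  have : (q + 1 <= (block_rev q (2 * k)).+1 + (block_rev q (2 * k).+1).+1)%N.
    by rewrite /block_rev; case: ifP => h; case: ifP => h'; lia.
  rewrite -(ler_nat R) !natrD; lra.
(* The quadratic bound is carried along only while the pairs fit in the
   block; beyond it, positivity is enough for the induction. *)
suff main K : (2 * K.+1 <= n)%N -> 0 < \sum_(k < K.+1) d k /\
    ((2 * K.+1 <= q)%N -> K%:R * (q%:R - 1 - 2 * K%:R) < \sum_(k < K.+1) d k).
  by case=> // K _ /main[].
elim: K => [_|K IHK Kn].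
  by rewrite big_ord_recr big_ord0 /= add0r mul0r.
have [|S_pos S_gt] := IHK; first by lia.
rewrite big_ord_recr /=.
have [Kq|qK] := ltnP (2 * K.+1).+1 q; last first.
  by split; [rewrite addr_gt0 // d_far //; lia | lia].
have dK := d_block K.+1 isT Kq.
have {}S_gt := S_gt ltac:(lia).
have gt : K.+1%:R * (q%:R - 1 - 2 * K.+1%:R) < \sum_(i < K.+1) d i + d K.+1.
  by move: S_gt dK; rewrite -natr1; nra.
split=> //; apply: le_lt_trans gt; apply: mulr_ge0 => //.
have : ((2 * K.+1).+1 <= q)%N by lia.
by rewrite -(ler_nat R) -natr1 natrM; lra.
Qed.

Theorem theorem3p23 (R : realType) (n : nat) (hn : (2 <= n)%N)
  (lambda : 'rV[R]_n)
  (lambda_decr : forall i j : 'I_n, (i <= j)%N -> lambda 0 j <= lambda 0 i)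
  (lambda_int : forall i j : 'I_n, lambda 0 i - lambda 0 j \is a Num.int)
  (i1 i2 : 'I_n) (hi1 : nat_of_ord i1 = 0%N) (hi2 : nat_of_ord i2 = 1%N)
  (lambda12 : lambda 0 i2 < lambda 0 i1)
  (q : nat) (hq : (2 <= q <= n)%N)
  (hq_eq : forall i : 'I_n, (1 <= i < q)%N -> lambda 0 i = lambda 0 i2)
  (hq_lt : forall i k : 'I_n, i.+1 = q -> nat_of_ord k = q ->
     lambda 0 k < lambda 0 i)
  (hlambda : lambda 0 i1 + lambda 0 i2 < - (2 * n%:R) + q%:R + 2)
  (s : 'rV[int]_n) (hs0 : s <> 0)
  (j : nat) (hj : (1 <= j <= n./2)%N)
  (b : nat -> int)
  (b_pos : forall k : nat, (k < j)%N -> 0 < b k)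
  (b_decr : forall k l : nat, (k <= l)%N -> (l < j)%N -> b l <= b k)
  (hs : s = doubled n j b) :
  enorm (domr (lambda - map_mx intr s) + rho R n) ^+ 2
    > enorm (lambda + rho R n) ^+ 2.
Proof.
have [_ qn] := andP hq; have [j0 jn] := andP hj.
have gap : lambda 0 i2 + 1 <= lambda 0 i1.
  have /intrP[z zE] := lambda_int i1 i2.
  have : 0 < z by rewrite -(ltr0z R) -zE subr_gt0.
  by rewrite gtz0_ge1 -(ler1z R) -zE lerBrDl.
pose w_fun (i : 'I_n) := Ordinal (@ltn_block_rev n q i qn (ltn_ord i)).
have w_funK : involutive w_fun by move=> i; apply/val_inj/block_revK.
pose w : 'S_n := perm (inv_inj w_funK).
have wE i : w i = block_rev q i :> nat by rewrite permE.
have w_lambda i : lambda 0 (w i) = lambda 0 i.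
  have := wE i; rewrite /block_rev; case: ifP => [iq wi|_ /val_inj-> //].
  by rewrite (hq_eq i iq) hq_eq // wi; lia.
have w_w i : w (w i) = i by rewrite !permE.
apply: lt_le_trans (@enorm_domr_add_rho_ge _ _ _ w).
(* Pairs of consecutive coordinates are easier to handle with coordinates as
   functions on [nat]; the default [i1] covers indices beyond [n]. *)
pose x k := lambda 0 (insubd i1 k).
have xE (i : 'I_n) : x i = lambda 0 i by rewrite /x valKd.
have x0E : x 0%N = lambda 0 i1 by rewrite -(xE i1) hi1.
have x1E : x 1%N = lambda 0 i2 by rewrite -(xE i2) hi2.
pose sigma k : R := if (k < 2 * j)%N then (b k./2)%:~R else 0.
pose F k := sigma k ^+ 2 - 2 * sigma k * shifted R n q x k.
suff F_pos : 0 < \sum_(i < n) F i.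
  rewrite !enorm_add_sqr ltrD2r.
  have perm_sum (G : 'I_n -> R) : \sum_i G i = \sum_i G (w i).
    exact: (reindex_inj (@perm_inj _ w)).
  rewrite -subr_gt0 [X in _ + 2 * X - _]perm_sum [X in X + _ - _]perm_sum.
  rewrite [X in _ - (_ + 2 * X)]perm_sum !mulr_sumr -!big_split -sumrB /=.
  rewrite (eq_bigr (fun i : 'I_n => F i)) // => i _.
  rewrite !mxE w_w w_lambda wE hs mxE /F /sigma /shifted xE.
  by case: ifP => _ //; lra.
have n2j : (2 * j <= n)%N by lia.
have -> : \sum_(i < n) F i = \sum_(i < 2 * j) F i.
  rewrite (big_ord_widen _ F n2j) [RHS]big_mkcond /=; apply: eq_bigr => i _.
  by rewrite /F /sigma; case: ifP => // _; rewrite expr2 !(mulr0, mul0r) subr0.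
rewrite sum_pairs.
pose d k := 1 - (shifted R n q x (2 * k)%N + shifted R n q x (2 * k).+1).
have bd_pos : 0 < \sum_(k < j) (b k)%:~R * d k.
  apply: (@sum_mul_partial_sums_gt0 R j (fun k => (b k)%:~R)) => //.
  - by move=> k kj; rewrite ltr0z b_pos.
  - by move=> k kj; rewrite ler_int b_decr.
  move=> K /andP[K0 Kj]; apply: pair_defect_partial_sums_gt0 => //; last by lia.
  - move=> k kq; have kn : (k < n)%N by lia.
    by rewrite x1E (xE (Ordinal kn) : x k = _) (hq_eq (Ordinal kn)).
  - move=> k kq; have kn : (k < n)%N by lia.
    by rewrite x1E (xE (Ordinal kn) : x k = _) lambda_decr // hi2 /=; lia.
  - by rewrite x0E x1E.
  - by rewrite x0E x1E.
apply: (@lt_le_trans _ _ (2 * \sum_(k < j) (b k)%:~R * d k)).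
  by rewrite mulr_gt0.
rewrite mulr_sumr; apply: ler_sum => -[k kj] _ /=.
(* [2 b^2 - 2 b c >= 2 b (1 - c)] because [b >= 1]. *)
have b1 : 1 <= (b k)%:~R :> R by rewrite ler1z -gtz0_ge1 b_pos.
rewrite /F /sigma.
have -> : (2 * k < 2 * j)%N by lia.
have -> : ((2 * k).+1 < 2 * j)%N by lia.
have -> : ((2 * k)./2 = k)%N by lia.
have -> : ((2 * k).+1./2 = k)%N by lia.
by rewrite /d; nra.
Qed.
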